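(* Let $a, b$ be integers with $2 \le a < b$ and $a \mid b$. Then there exists $C > 0$, depending only on $a$ and $b$, such that for all sufficiently large integers $n$ (the threshold depending only on $a$, $b$ and $C$) and every positive integer $N$ divisible by $a^n$ but not by $b$, one has \[ c_b(N) > C \log n. \] Moreover, any constant $C$ with $0 < C < \left(\log\left(\frac{\log b}{\log a}\right)\right)^{-1}$ is admissible.
   Context: For an integer $b \ge 2$ and a nonnegative integer $N$, $c_b(N)$ denotes the number of nonzero digits in the base-$b$ expansion of $N$. $\log$ denotes the natural logarithm. *)

(* Defs.v *)
From mathcomp Require Import all_boot all_order all_algebra.
From mathcomp Require Import reals exp.

Set Implicit Arguments.
Unset Strict Implicit.
Unset Printing Implicit Defensive.

Import Order.TTheory GRing.Theory Num.Theory.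

(* Least significant digit first. For 1 < b and 0 < N, [trunc_log b N] is the
   position of the leading digit; 0 is expanded as the single digit 0. *)
Definition digits (b N : nat) : seq nat :=
  mkseq (fun i => (N %/ b ^ i) %% b) (trunc_log b N).+1.

Definition nonzero_digits (b N : nat) : nat :=
  count (fun d => d != 0) (digits b N).

Local Open Scope ring_scope.

Definition admissible (R : realType) (a b : nat) (C : R) : Prop :=
  exists n0 : nat, forall n : nat, (n0 <= n)%N ->
    forall N : nat, (0 < N)%N -> (a ^ n %| N)%N -> ~~ (b %| N)%N ->
      (nonzero_digits b N)%:R > C * ln n%:R.

(* Main.v *)
Require Import Defs.
From mathcomp Require Import all_boot all_order all_algebra.
From mathcomp Require Import reals exp.
From mathcomp Require Import sequences zify ring lra.

Import Order.TTheory GRing.Theory Num.Theory.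

Local Open Scope ring_scope.

(** Let [r = ln b / ln a > 1] and consider windows of digit positions
    [[t, u)] with [b ^ t <= a ^ u] and [u <= n].  If all digits of [N] in such a
    window vanished, then [N mod b ^ u = N mod b ^ t] would be a positive
    multiple of [a ^ u] (recall that [a ^ u] divides both [N] and [b ^ u])
    smaller than [b ^ t <= a ^ u].  So each window contains a nonzero digit.
    Taking each [u] minimal, consecutive windows end at positions growing at
    most like [u < r t + 1], i.e. like [r ^ j], so about [ln n / ln r] of them fit
    below [n]. *)

(** The cutoff [t] is independent of the length of the expansion and may exceed it. *)
Definition count_below (b N t : nat) : nat :=
  count (fun i => (N %/ b ^ i) %% b != 0)%N (iota 0 t).

Lemma modn_expS (b N i : nat) :
  (N %% b ^ i.+1 = (N %/ b ^ i) %% b * b ^ i + N %% b ^ i)%N.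
Proof.
(* Both sides become the Euclidean division of [N %% b ^ i.+1] by [b ^ i]. *)
rewrite modn_divl -expnS -[X in (_ + X)%N](@modn_dvdm (b ^ i.+1)).
  exact: divn_eq.
exact: dvdn_exp2l.
Qed.

Lemma count_belowD (b N t d : nat) :
  (count_below b N (t + d) =
   count_below b N t + count (fun i => (N %/ b ^ i) %% b != 0) (iota t d))%N.
Proof. by rewrite /count_below iotaD count_cat add0n. Qed.

Lemma modn_exp_stable (b N t d : nat) :
  count (fun i => (N %/ b ^ i) %% b != 0)%N (iota t d) = 0%N ->
  (N %% b ^ (t + d) = N %% b ^ t)%N.
Proof.
elim: d => [|d IH]; first by rewrite addn0.
rewrite -addn1 iotaD count_cat /= addn0 => /eqP.
rewrite addn_eq0 eqb0 negbK => /andP[/eqP/IH <- /eqP dig0].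
by rewrite addn1 addnS modn_expS dig0 mul0n add0n.
Qed.

Lemma count_below_le (b N t : nat) :
  (1 < b)%N -> (count_below b N t <= nonzero_digits b N)%N.
Proof.
move=> b1; set L := (trunc_log b N).+1.
have -> : nonzero_digits b N = count_below b N L.
  by rewrite /nonzero_digits /digits /mkseq count_map.
have [tL|/ltnW Lt] := leqP t L.
  by rewrite -(subnKC tL) count_belowD leq_addr.
(* Positions beyond the leading digit contribute nothing. *)
rewrite -(subnKC Lt) count_belowD -[leqRHS]addn0 leq_add2l leqNgt.
rewrite -has_count; apply/hasPn => i; rewrite mem_iota => /andP[Li _].
have Nb : (N < b ^ i)%N.
  by apply: leq_trans (trunc_log_ltn N b1) _; rewrite leq_exp2l.
by rewrite divn_small // mod0n.
Qed.

Lemma count_below_window (a b n N t u : nat) :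
  (a %| b)%N -> (0 < b)%N -> (a ^ n %| N)%N -> ~~ (b %| N)%N ->
  (0 < t)%N -> (t <= u <= n)%N -> (b ^ t <= a ^ u)%N ->
  (count_below b N t < count_below b N u)%N.
Proof.
move=> ab b0 aN bN t0 /andP[tu un] btau.
rewrite -(subnKC tu) count_belowD -[ltnLHS]addn0 ltn_add2l lt0n.
apply/eqP => /modn_exp_stable; rewrite subnKC // => modE.
have auM : (a ^ u %| N %% b ^ t)%N.
  rewrite -modE /dvdn modn_dvdm ?dvdn_exp2r //.
  exact: dvdn_trans (dvdn_exp2l a un) aN.
(* Since [0 < t], a zero remainder would give [b %| b ^ t %| N]. *)
have M0 : (0 < N %% b ^ t)%N.
  rewrite lt0n; apply: contra bN; exact/dvdn_trans/dvdn_exp.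
have := dvdn_leq M0 auM; rewrite leqNgt (leq_trans _ btau) //.
by rewrite ltn_pmod // expn_gt0 b0.
Qed.

(** [up_log a (b ^ t)] is the least [u] with [b ^ t <= a ^ u]. The start 1 isolates the units digit,
    which is nonzero because [b] does not divide [N]. *)
Definition window_end (a b j : nat) : nat :=
  iter j (fun t => up_log a (b ^ t)) 1%N.

Lemma window_end_le (a b j : nat) : (1 < a)%N -> (a < b)%N ->
  (window_end a b j <= window_end a b j.+1)%N.
Proof.
move=> a1 ab; rewrite /window_end iterS; set t := iter _ _ _.
have b1 : (1 < b)%N by apply: ltn_trans ab.
(* With [u] the next end, [b ^ t <= a ^ u <= b ^ u]. *)
rewrite -(leq_exp2l _ _ b1); apply: leq_trans (up_logP (b ^ t) a1) _.
by case: up_log => // k; rewrite leq_exp2r // ltnW.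
Qed.

Lemma window_end_gt0 (a b j : nat) : (1 < a)%N -> (a < b)%N ->
  (0 < window_end a b j)%N.
Proof.
move=> a1 ab; elim: j => // j IH.
exact: leq_trans IH (window_end_le a b j a1 ab).
Qed.

Lemma ltn_count_below_window_end (a b n N j : nat) :
  (1 < a)%N -> (a < b)%N -> (a %| b)%N -> (a ^ n %| N)%N -> ~~ (b %| N)%N ->
  (window_end a b j <= n)%N -> (j < count_below b N (window_end a b j))%N.
Proof.
move=> a1 ab adb aN bN; elim: j => [|j IH] jn.
  by rewrite /count_below /= expn0 divn1 addn0 lt0b.
have le_j := window_end_le a b j a1 ab.
apply: leq_ltn_trans (IH (leq_trans le_j jn)) _.
apply: (count_below_window a b n) => //; first by apply: leq_ltn_trans ab.
- exact: window_end_gt0.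
- by rewrite le_j jn.
- exact: up_logP.
Qed.

Lemma ln_ratio_gt1 (R : realType) (a b : nat) : (1 < a)%N -> (a < b)%N ->
  1 < ln b%:R / ln a%:R :> R.
Proof.
move=> a1 ab; rewrite ltr_pdivlMr ?ln_gt0 ?ltr1n // mul1r.
by rewrite ltr_ln ?ltr_nat ?posrE ?ltr0n; lia.
Qed.

(** The right-hand side is the exact solution of [x_(j+1) = r * x_j + 1] with [x_0 = 1], and the
    window ends satisfy this recurrence as an inequality. *)
Lemma window_end_bound (R : realType) (a b j : nat) :
  (1 < a)%N -> (a < b)%N -> forall r : R, r = ln b%:R / ln a%:R ->
  (window_end a b j)%:R <= r / (r - 1) * r ^+ j - (r - 1)^-1.
Proof.
move=> a1 ab r rE.
have lna : 0 < ln (a%:R : R) by rewrite ln_gt0 // ltr1n.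
have r1 : 1 < r by rewrite rE ln_ratio_gt1.
have r1N : r - 1 != 0 by rewrite subr_eq0 gt_eqF.
elim: j => [|j IH].
  by rewrite expr0 mulr1 -{2}[(r - 1)^-1]mul1r -mulrBl divff.
have t0 := window_end_gt0 a b j a1 ab.
rewrite [window_end _ _ _]iterS -/(window_end a b j).
set t := window_end a b j in IH t0 *; set u := up_log _ _.
have b1 : (1 < b ^ t)%N by rewrite -(expn0 b) ltn_exp2l //; lia.
have ltu : u%:R <= r * t%:R + 1.
  (* Minimality of [u] gives [a ^ u.-1 < b ^ t]; taking logarithms, [u - 1 < r * t]. *)
  have /andP[] := up_log_bounds a1 b1; rewrite -/u => + _.
  rewrite -(ltr_nat R) !natrX -ltr_ln ?posrE ?exprn_gt0 ?ltr0n; [|lia..].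
  rewrite !lnXn ?ltr0n; [|lia..].
  rewrite -[_ *+ u.-1]mulr_natr -[_ *+ t]mulr_natr => lt_ln.
  have u0 : (0 < u)%N by rewrite up_log_gt0 a1.
  rewrite -(prednK u0) -natr1 lerD2r ltW // rE mulrAC ltr_pdivlMr //.
  by rewrite mulrC.
apply: le_trans ltu _.
apply: (@le_trans _ _ (r * (r / (r - 1) * r ^+ j - (r - 1)^-1) + 1)).
  by rewrite lerD2r ler_wpM2l //; lra.
rewrite le_eqVlt; apply/orP; left; apply/eqP; rewrite exprS; field.
exact: r1N.
Qed.

Lemma admissible_lt (R : realType) (a b : nat) (C : R) :
  (1 < a)%N -> (a < b)%N -> (a %| b)%N -> 0 < C ->
  C < (ln (ln b%:R / ln a%:R))^-1 -> admissible a b C.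
Proof.
move=> a1 ab adb C0; set r : R := ln b%:R / ln a%:R => Cr.
have r1 : 1 < r by apply: ln_ratio_gt1.
have lnr : 0 < ln r by rewrite ln_gt0.
have Clnr : 0 < 1 - C * ln r.
  by rewrite subr_gt0 -ltr_pdivlMr // mul1r.
set K := r / (r - 1).
have K0 : 0 < K by apply: divr_gt0; lra.
(* The threshold ensures [ln K + C * ln r * ln n <= ln n], hence [K * r ^+ j <= n] for every
   [j <= C * ln n]. *)
exists (Num.trunc (expR (ln K / (1 - C * ln r)))).+1 => n n0n N N0 aN bN.
have n0 : 0 < n%:R :> R by rewrite ltr0n; apply: leq_trans n0n.
have lnn : ln K / (1 - C * ln r) <= ln n%:R.
  rewrite -ler_expR lnK ?posrE //; apply: le_trans (ltW (truncnS_gt _)) _.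
  by rewrite ler_nat.
have Cn0 : 0 <= C * ln n%:R.
  by rewrite mulr_ge0 ?(ltW C0) // ln_ge0 // ler1n; apply: leq_trans n0n.
(* With this floor, the at least [j.+1] nonzero digits found below [window_end a b j] exceed
   [C * ln n]. *)
set j := Num.trunc (C * ln n%:R).
have /andP[jC Cj] : j%:R <= C * ln n%:R < j.+1%:R by apply: truncn_itv.
apply: lt_le_trans Cj _; rewrite ler_nat.
have wn : (window_end a b j <= n)%N.
  rewrite -(ler_nat R).
  apply: le_trans (@window_end_bound R a b j a1 ab r erefl) _.
  apply: (@le_trans _ _ (K * r ^+ j)); first by rewrite gerBl invr_ge0; lra.
  have rj0 : 0 < r ^+ j by apply: exprn_gt0; lra.
  have Krj0 : 0 < K * r ^+ j by apply: mulr_gt0.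
  rewrite -ler_ln ?posrE // lnM ?posrE // lnXn; last lra.
  rewrite -[_ *+ j]mulr_natl -lerBrDr.
  move: lnn; rewrite ler_pdivrMr // => /le_trans; apply.
  rewrite mulrBr mulr1 lerD2l lerN2 mulrCA mulrA.
  by rewrite ler_wpM2r // ltW.
apply: leq_trans (ltn_count_below_window_end _ _ _ _ _ a1 ab adb aN bN wn) _.
by apply: count_below_le; apply: ltn_trans ab.
Qed.

Theorem theorem4p2 (R : realType) (a b : nat) (ha : (2 <= a)%N) (hab : (a < b)%N)
    (hdvd : (a %| b)%N) :
  (exists C : R, 0 < C /\ admissible a b C) /\
  (forall C : R, 0 < C -> C < (ln (ln b%:R / ln a%:R))^-1 -> admissible a b C).
Proof.
have adm C := @admissible_lt R a b C ha hab hdvd.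
split=> [|C]; last exact: adm.
have lnr : 0 < (ln (ln (b%:R : R) / ln a%:R))^-1.
  by rewrite invr_gt0 ln_gt0 // ln_ratio_gt1.
exists ((ln (ln b%:R / ln a%:R))^-1 / 2).
by split; [|apply: adm]; lra.
Qed.
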